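(* Let $k$ be a field of characteristic $p\ge0$ with algebraic closure $\overline k$, let $X=(x_1,\dots,x_n)$, and let $$\sigma=\sum_{I\in\mathbb N^n}\alpha_IX^I\in\overline k[[X]],\qquad \alpha_I\in\overline k,$$ where $X^I=x_1^{i_1}\cdots x_n^{i_n}$. Let $L=k(\{\alpha_I\mid I\in\mathbb N^n\})\subset\overline k$ be the field generated over $k$ by the coefficients of $\sigma$. Then $\sigma$ is algebraic over $k((X))$ (the fraction field of $k[[X]]$) if and only if there exists $r\in\mathbb N$ such that $[kL^{p^r}:k]<\infty$, where $kL^{p^r}$ is the compositum of $k$ and $L^{p^r}$ in $\overline k$.
   Context: For a field $L$ of characteristic $p>0$ and $r\in\mathbb N$, $L^{p^r}=\{f^{p^r}\mid f\in L\}$; if the characteristic is $0$, set $L^{p^r}=L$. *)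

(* Defs.v *)
From HB Require Import structures.
From mathcomp Require Import all_boot all_order all_algebra.
Set Implicit Arguments. Unset Strict Implicit. Unset Printing Implicit Defensive.
Import GRing.Theory.
Local Open Scope ring_scope.

Definition mi (n : nat) := {ffun 'I_n -> nat}.

Definition pseries (R : Type) (n : nat) := mi n -> R.

Definition ps_one (R : nzRingType) (n : nat) : pseries R n :=
  fun I => if [forall i, I i == 0%N] then 1 else 0.

Definition ps_add (R : nzRingType) (n : nat) (f g : pseries R n) : pseries R n :=
  fun I => f I + g I.

Definition ps_mul (R : nzRingType) (n : nat) (f g : pseries R n) : pseries R n :=
  fun I => \sum_(J : {dffun forall i : 'I_n, 'I_(I i).+1})
             f [ffun i => nat_of_ord (J i)] * g [ffun i => (I i - J i)%N].

Fixpoint ps_pow (R : nzRingType) (n : nat) (f : pseries R n) (j : nat) : pseries R n :=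
  if j is j'.+1 then @ps_mul R n f (ps_pow f j') else @ps_one R n.

Definition ps_map (k K : Type) (iota : k -> K) (n : nat) (a : pseries k n) : pseries K n :=
  fun I => iota (a I).

(* sigma in K[[X]] is algebraic over k((X)) = Frac(k[[X]]): equivalently
   (clearing denominators) there are a_0,...,a_d in k[[X]], not all zero,
   with sum_j a_j sigma^j = 0 in K[[X]]. *)
Definition ps_algebraic (k K : fieldType) (iota : {rmorphism k -> K}) (n : nat)
  (sigma : pseries K n) : Prop :=
  exists (d : nat) (a : 'I_d.+1 -> pseries k n),
    (exists j I, a j I != 0) /\
    forall I, \sum_(j < d.+1) ps_mul (ps_map iota (a j)) (ps_pow sigma j) I = 0.

Definition is_subfield (K : fieldType) (F : K -> Prop) : Prop :=
  [/\ F 1, (forall x y, F x -> F y -> F (x - y)),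
      (forall x y, F x -> F y -> F (x * y)) & (forall x, F x -> F x^-1)].

Definition gen_field (k K : fieldType) (iota : {rmorphism k -> K}) (S : K -> Prop)
  : K -> Prop :=
  fun x => forall F : K -> Prop, is_subfield F -> (forall c, F (iota c)) ->
             (forall s, S s -> F s) -> F x.

Definition finite_over (k K : fieldType) (iota : {rmorphism k -> K}) (E : K -> Prop) : Prop :=
  exists (m : nat) (e : 'I_m -> K),
    forall x, E x -> exists c : 'I_m -> k, x = \sum_(i < m) iota (c i) * e i.

Definition is_char (R : nzRingType) (p : nat) : Prop :=
  if p == 0%N then [pchar R] =i pred0 else p \in [pchar R].

(* L^{p^r} = { f^{p^r} | f in L }, and L^{p^r} = L in characteristic 0. *)
Definition frob_exp (p r : nat) : nat := if p == 0%N then 1%N else (p ^ r)%N.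

Definition frob_image (K : fieldType) (p r : nat) (L : K -> Prop) : K -> Prop :=
  fun y => exists2 f, L f & y = f ^+ frob_exp p r.

(* Main.v *)
Require Import Defs.
From HB Require Import structures.
From mathcomp Require Import all_boot all_order all_algebra.
From mathcomp Require Import boolp ring zify.
Import GRing.Theory.
Local Open Scope ring_scope.
Set Implicit Arguments.
Unset Strict Implicit.
Unset Printing Implicit Defensive.

(* The proof rests on the following fact. Suppose P(tau) = 0 and delta = P'(tau) <> 0, with
   P over k[[X]] and tau in K[[X]]. Choose positive weights on the variables for which delta
   has a unique exponent D of least weight. If h is the tail of tau starting at the weight of
   I, and I is heavier than D, then the coefficient at D + I of
   P(tau - h) = - h * delta + h^2 * Q shows that tau_I lies in the field generated over k by
   the lighter coefficients of tau. Hence all coefficients of tau lie in a field generated by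
   finitely many algebraic elements.

   If sigma is algebraic, this applies to some tau = sigma^(p^r), whose coefficients are the
   p^r-th powers of those of sigma. Conversely, if E = k L^(p^r) has a finite basis over k,
   multiplication by sigma^(p^r) on the free k[[X]]-module on this basis has a characteristic
   polynomial, which is monic and annihilates sigma^(p^r). *)

(** * The ring of power series *)

(** Listing the exponents below [I] as plain elements of [mi n], instead of dependent finite
    functions, lets sums for different [I] share one index list and be exchanged. *)
Definition box n (I : mi n) : seq (mi n) :=
  [seq [ffun i => nat_of_ord (J i)] | J : {dffun forall i : 'I_n, 'I_(I i).+1}].

Lemma sum_pred1_seq (V : nmodType) (T : eqType) (s : seq T) (x : T) (F : T -> V) :
  uniq s -> x \in s -> \sum_(y <- s | y == x) F y = F x.
Proof. by move=> us xs; rewrite -big_filter filter_pred1_uniq // big_seq1. Qed.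

Lemma mem_box n (I J : mi n) : (J \in box I) = [forall i, J i <= I i]%N.
Proof.
apply/imageP/forallP => [[f _ ->] i|leJI].
  by rewrite ffunE -ltnS.
exists [ffun i : 'I_n => inord (J i) : 'I_(I i).+1] => //.
by apply/ffunP=> i; rewrite !ffunE inordK ?ltnS.
Qed.

Lemma box_uniq n (I : mi n) : uniq (box I).
Proof.
rewrite map_inj_uniq ?enum_uniq // => f g /ffunP fg.
by apply/ffunP=> i; apply/val_inj; have := fg i; rewrite !ffunE.
Qed.

Lemma mem_box_add n (I J M : mi n) : I + J = M -> (I \in box M) && (J \in box M).
Proof.
move=> <-; rewrite !mem_box; apply/andP; split; apply/forallP=> i.
  by rewrite ffunE leq_addr.
by rewrite ffunE leq_addl.
Qed.

Lemma mi_addE n (I J : mi n) i : (I + J) i = (I i + J i)%N.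
Proof. by rewrite ffunE. Qed.

Lemma mi_addIr n (I : mi n) : injective (+%R I).
Proof.
move=> J K /ffunP E; apply/ffunP => i.
by have := E i; rewrite !ffunE => /addnI.
Qed.

(** Pairs with sum [I] lie in [box I], so enlarging the list adds only empty inner sums. In a triple
    product, the inner product can thus be summed over the box of the outer exponent. *)
Lemma ps_mulE (R : nzRingType) n (f g : pseries R n) (I : mi n) (s : seq (mi n)) :
  uniq s -> {subset box I <= s} ->
  ps_mul f g I = \sum_(J <- s) \sum_(K <- s | J + K == I) f J * g K.
Proof.
move=> us sub.
have -> : ps_mul f g I = \sum_(J <- box I) f J * g [ffun i => (I i - J i)%N].
  rewrite big_image /=; apply: eq_bigr => J _; congr (_ * g _).
  by apply/ffunP => i; rewrite !ffunE.
have pe : perm_eq (box I) [seq J <- s | J \in box I].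
  apply: uniq_perm; rewrite ?box_uniq ?filter_uniq // => J.
  by rewrite mem_filter andb_idr // => /sub.
rewrite (perm_big _ pe) /= big_filter big_mkcond; apply: eq_bigr => J _.
case: ifPn => [JI|nJI]; last first.
  rewrite big1 // => K /eqP /mem_box_add /andP[JI _].
  by rewrite JI in nJI.
have E : J + [ffun i => (I i - J i)%N] = I.
  move: JI; rewrite mem_box => /forallP JI.
  by apply/ffunP=> i; rewrite !ffunE; apply: subnKC.
rewrite (eq_bigl (pred1 [ffun i => (I i - J i)%N])); last first.
  by move=> K /=; rewrite -[in LHS]E (inj_eq (@mi_addIr n J)).
rewrite sum_pred1_seq // sub //.
by have /mem_box_add/andP[] := E.
Qed.

Lemma ps_mul_box (R : nzRingType) n (f g : pseries R n) (I : mi n) :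
  ps_mul f g I = \sum_(J <- box I) \sum_(K <- box I | J + K == I) f J * g K.
Proof. by apply: ps_mulE; rewrite ?box_uniq. Qed.

(** An expansion symmetric in the three exponents: with commutativity, associativity becomes a
    reordering of sums. *)
Lemma ps_mulA3 (R : comNzRingType) n (f g h : pseries R n) (I : mi n) :
  ps_mul f (ps_mul g h) I =
  \sum_(J <- box I) \sum_(K <- box I) \sum_(L <- box I | J + K + L == I)
    f J * g K * h L.
Proof.
rewrite ps_mul_box; apply: eq_bigr => J _.
transitivity (\sum_(M <- box I | J + M == I) \sum_(K <- box I)
    \sum_(L <- box I | K + L == M) f J * g K * h L).
  apply: eq_bigr => M /eqP /mem_box_add /andP[_ MI].
  rewrite (@ps_mulE _ _ g h M (box I)) ?box_uniq //; last first.
    move=> K; move: MI; rewrite !mem_box => /forallP MI /forallP KM.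
    by apply/forallP=> i; exact: leq_trans (KM i) (MI i).
  rewrite mulr_sumr; apply: eq_bigr => K _.
  by rewrite mulr_sumr; apply: eq_bigr => L _; rewrite mulrA.
rewrite exchange_big /=; apply: eq_bigr => K _.
rewrite (exchange_big_dep predT) //= [RHS]big_mkcond /=; apply: eq_bigr => L _.
case: ifPn => [/eqP E|nE].
  (* For fixed [K] and [L], the intermediate exponent [M] can only be [K + L]. *)
  rewrite (eq_bigl (pred1 (K + L))); last first.
    move=> M /=; rewrite eq_sym [K + L == M]eq_sym andbC.
    by case: eqP => // ->; rewrite addrA E eqxx.
  rewrite sum_pred1_seq ?box_uniq //.
  by have /mem_box_add/andP[] : J + (K + L) = I by rewrite addrA.
rewrite big1 // => M /andP[/eqP E /eqP F].
by move: nE; rewrite -addrA F E eqxx.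
Qed.

Lemma ps_mulC (R : comNzRingType) n : commutative (@ps_mul R n).
Proof.
move=> f g; apply/funext => I; rewrite !ps_mul_box (exchange_big_dep predT) //=.
by apply: eq_bigr => J _; apply: eq_big => K; rewrite 1?addrC // mulrC.
Qed.

Lemma ps_mulA (R : comNzRingType) n : associative (@ps_mul R n).
Proof.
move=> f g h; rewrite [RHS]ps_mulC; apply/funext => I; rewrite !ps_mulA3.
under [RHS]eq_bigr do under eq_bigr do rewrite big_mkcond.
rewrite [RHS]exchange_big; apply: eq_bigr => J _ /=.
rewrite [RHS]exchange_big; apply: eq_bigr => K _ /=.
rewrite big_mkcond; apply: eq_bigr => L _ /=.
by rewrite -[L + J + K]addrA [L + _]addrC -[h L * _ * _]mulrA [h L * _]mulrC.
Qed.

Lemma ps_oneE (R : nzRingType) n (I : mi n) :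
  @ps_one R n I = (I == 0)%:R.
Proof.
rewrite /ps_one; have -> : [forall i, I i == 0%N] = (I == 0); last by case: eqP.
apply/forallP/eqP => [E|-> i]; last by rewrite ffunE.
by apply/ffunP => i; rewrite ffunE; apply/eqP.
Qed.

Lemma ps_mul1 (R : nzRingType) n : left_id (@ps_one R n) (@ps_mul R n).
Proof.
move=> f; apply/funext => I; rewrite ps_mul_box.
have /mem_box_add/andP[I0 II] := add0r I.
rewrite (bigD1_seq 0) ?box_uniq //= [X in _ + X]big1 => [|J /negPf J0]; last first.
  by rewrite big1 // => K _; rewrite ps_oneE J0 mul0r.
rewrite addr0 ps_oneE eqxx (eq_bigl (pred1 I)); last by move=> J /=; rewrite add0r.
by rewrite sum_pred1_seq ?box_uniq // mul1r.
Qed.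

Lemma ps_mulDl (R : nzRingType) n : left_distributive (@ps_mul R n) (@ps_add R n).
Proof.
move=> f g h; apply/funext => I; rewrite /ps_add !ps_mul_box -big_split /=.
apply: eq_bigr => J _; rewrite -big_split /=.
by apply: eq_bigr => K _; rewrite mulrDl.
Qed.

Lemma ps_addA (R : nzRingType) n : associative (@ps_add R n).
Proof. by move=> f g h; apply/funext => I; rewrite /ps_add addrA. Qed.

Lemma ps_addC (R : nzRingType) n : commutative (@ps_add R n).
Proof. by move=> f g; apply/funext => I; rewrite /ps_add addrC. Qed.

Lemma ps_add0 (R : nzRingType) n : left_id (fun=> 0) (@ps_add R n).
Proof. by move=> f; apply/funext => I; rewrite /ps_add add0r. Qed.

Lemma ps_addN (R : nzRingType) n :
  left_inverse (fun=> 0) (fun (f : pseries R n) I => - f I) (@ps_add R n).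
Proof. by move=> f; apply/funext => I; rewrite /ps_add addNr. Qed.

(** Series are functions on an infinite set, so equality and choice are classical here; polynomials
    and matrices over [pseries R n] rely on these structures. *)
HB.instance Definition _ (R : comNzRingType) n := gen_eqMixin (pseries R n).
HB.instance Definition _ (R : comNzRingType) n := gen_choiceMixin (pseries R n).
HB.instance Definition _ (R : comNzRingType) n :=
  GRing.isZmodule.Build (pseries R n)
    (@ps_addA R n) (@ps_addC R n) (@ps_add0 R n) (@ps_addN R n).

Lemma ps_one_neq0 (R : comNzRingType) n : @ps_one R n != 0 :> pseries R n.
Proof.
by apply/eqP => /(congr1 (@^~ 0)) /eqP; rewrite ps_oneE eqxx oner_eq0.
Qed.

HB.instance Definition _ (R : comNzRingType) n :=
  GRing.Zmodule_isComNzRing.Build (pseries R n)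
    (@ps_mulA R n) (@ps_mulC R n) (@ps_mul1 R n) (@ps_mulDl R n) (@ps_one_neq0 R n).

Lemma psD (R : comNzRingType) n (f g : pseries R n) I : (f + g) I = f I + g I.
Proof. by []. Qed.

Lemma psN (R : comNzRingType) n (f : pseries R n) I : (- f) I = - f I.
Proof. by []. Qed.

Lemma ps0 (R : comNzRingType) n I : (0 : pseries R n) I = 0.
Proof. by []. Qed.

Lemma ps1 (R : comNzRingType) n I : (1 : pseries R n) I = (I == 0)%:R.
Proof. exact: ps_oneE. Qed.

Lemma psM (R : comNzRingType) n (f g : pseries R n) : f * g = ps_mul f g.
Proof. by []. Qed.

Lemma psX (R : comNzRingType) n (f : pseries R n) j : f ^+ j = ps_pow f j.
Proof. by elim: j => [|j IH] //=; rewrite exprS IH. Qed.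

Lemma psMn (R : comNzRingType) n (f : pseries R n) j I : (f *+ j) I = f I *+ j.
Proof. by elim: j => // j IH; rewrite !mulrS psD IH. Qed.

Lemma ps_sum (R : comNzRingType) n (T : Type) (r : seq T) (P : pred T)
   (F : T -> pseries R n) I :
  (\sum_(i <- r | P i) F i) I = \sum_(i <- r | P i) F i I.
Proof. exact: (big_morph (fun f : pseries R n => f I)). Qed.

Lemma ps_map_is_zmod (k K : comNzRingType) (iota : {rmorphism k -> K}) n :
  zmod_morphism (@ps_map k K iota n).
Proof. by move=> f g; apply/funext => I; rewrite /ps_map !(psD, psN) rmorphB. Qed.

Lemma ps_map_is_monoid (k K : comNzRingType) (iota : {rmorphism k -> K}) n :
  monoid_morphism (@ps_map k K iota n).
Proof.
split; first by apply/funext => I; rewrite /ps_map !ps1 rmorph_nat.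
move=> f g; apply/funext => I; rewrite /ps_map !psM !ps_mul_box rmorph_sum.
by apply: eq_bigr => J _; rewrite rmorph_sum; apply: eq_bigr => L _; rewrite rmorphM.
Qed.

HB.instance Definition _ (k K : comNzRingType) (iota : {rmorphism k -> K}) n :=
  GRing.isZmodMorphism.Build (pseries k n) (pseries K n) (@ps_map k K iota n)
    (@ps_map_is_zmod k K iota n).
HB.instance Definition _ (k K : comNzRingType) (iota : {rmorphism k -> K}) n :=
  GRing.isMonoidMorphism.Build (pseries k n) (pseries K n) (@ps_map k K iota n)
    (@ps_map_is_monoid k K iota n).

(** * Finite extensions *)

(** The [k]-span of [e], built one term at a time, so that closure properties follow by induction
    without families of coefficients. *)
Inductive lspan (k K : fieldType) (iota : {rmorphism k -> K}) (e : seq K) : K -> Prop :=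
| lspan0 : lspan iota e 0
| lspan_cons a y x : y \in e -> lspan iota e x -> lspan iota e (iota a * y + x).

Lemma lspan_linear (k K : fieldType) (iota : {rmorphism k -> K}) e a x y :
  lspan iota e x -> lspan iota e y -> lspan iota e (iota a * x + y).
Proof.
move=> ex ey; elim: ex => [|b z {}x ze _ IH]; first by rewrite mulr0 add0r.
by rewrite mulrDr mulrA -rmorphM -addrA; apply: lspan_cons.
Qed.

Lemma lspan_mem (k K : fieldType) (iota : {rmorphism k -> K}) e x :
  x \in e -> lspan iota e x.
Proof.
by move=> xe; have := lspan_cons 1 xe (lspan0 iota e); rewrite rmorph1 mul1r addr0.
Qed.

Lemma lspanZ (k K : fieldType) (iota : {rmorphism k -> K}) e a x :
  lspan iota e x -> lspan iota e (iota a * x).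
Proof. by move=> ex; rewrite -[_ * _]addr0; apply: lspan_linear => //; apply: lspan0. Qed.

Lemma lspanD (k K : fieldType) (iota : {rmorphism k -> K}) e x y :
  lspan iota e x -> lspan iota e y -> lspan iota e (x + y).
Proof. by move=> ex ey; rewrite -[x]mul1r -(rmorph1 iota); apply: lspan_linear. Qed.

Lemma lspanB (k K : fieldType) (iota : {rmorphism k -> K}) e x y :
  lspan iota e x -> lspan iota e y -> lspan iota e (x - y).
Proof.
by move=> ex ey; rewrite addrC -mulN1r -(rmorphN1 iota); apply: lspan_linear.
Qed.

Lemma lspan_mul (k K : fieldType) (iota : {rmorphism k -> K}) e1 e2 e3 x y :
  (forall u v, u \in e1 -> v \in e2 -> lspan iota e3 (u * v)) ->
  lspan iota e1 x -> lspan iota e2 y -> lspan iota e3 (x * y).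
Proof.
move=> H ex ey; have H1 u : u \in e1 -> lspan iota e3 (u * y).
  move=> ue; elim: ey => [|b v {}y ve _ IH]; first by rewrite mulr0; apply: lspan0.
  by rewrite mulrDr mulrCA; apply: lspan_linear => //; apply: H.
elim: ex => [|a u {}x ue _ IH]; first by rewrite mul0r; apply: lspan0.
by rewrite mulrDl -mulrA; apply: lspan_linear => //; apply: H1.
Qed.

Lemma lspan_horner (k K : fieldType) (iota : {rmorphism k -> K}) e (g : {poly k}) x :
  (forall i, (i < size g)%N -> lspan iota e (x ^+ i)) -> lspan iota e (map_poly iota g).[x].
Proof.
move=> H; rewrite horner_coef size_map_poly.
elim/big_ind: _ => [|u v|i _]; [exact: lspan0|exact: lspanD|].
by rewrite coef_map /=; apply: lspanZ; apply: H.
Qed.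

(** The remainder of ['X^j] modulo [q] has the same value at the root [x] and involves only powers
    below [size q]. *)
Lemma lspan_powers (k K : fieldType) (iota : {rmorphism k -> K}) (q : {poly k}) x j :
  q != 0 -> root (map_poly iota q) x ->
  lspan iota (mkseq (fun i => x ^+ i) (size q)) (x ^+ j).
Proof.
move=> q0 /rootP qx.
have -> : x ^+ j = (map_poly iota ('X^j %% q)).[x].
  rewrite -[LHS]hornerXn -(map_polyXn iota) {1}(divp_eq 'X^j q).
  by rewrite rmorphD rmorphM hornerD hornerM qx mulr0 add0r.
apply: lspan_horner => i lti; apply/lspan_mem/mapP; exists i => //.
by rewrite mem_iota /= (ltn_trans lti) // ltn_modp.
Qed.

(** Elements are adjoined one by one: if [e] spans a ring, the products of its members with finitely
    many powers of an algebraic [x] span a ring that also contains [x]. *)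
Lemma lspan_ring_exists (k K : fieldType) (iota : {rmorphism k -> K}) :
  (forall x : K, exists2 q : {poly k}, q != 0 & root (map_poly iota q) x) ->
  forall s : seq K, exists e : seq K,
    [/\ lspan iota e 1, forall u v, lspan iota e u -> lspan iota e v -> lspan iota e (u * v)
      & forall x, x \in s -> lspan iota e x].
Proof.
move=> alg; elim=> [|x s [e [e1 eM es]]].
  have one1 : lspan iota [:: 1] 1 by apply: lspan_mem; rewrite inE.
  exists [:: 1]; split => // u v; apply: lspan_mul => {}u {}v.
  by rewrite !inE => /eqP -> /eqP ->; rewrite mulr1.
have [q q0 qx] := alg x; set f := mkseq (fun i => x ^+ i) (size q).
pose e' := [seq u * v | u <- e, v <- f].
have ef u v : lspan iota e u -> lspan iota f v -> lspan iota e' (u * v).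
  by apply: lspan_mul => {}u {}v ue vf; apply: lspan_mem; apply: allpairs_f.
have fX j : lspan iota f (x ^+ j) by apply: lspan_powers.
exists e'; split.
- by rewrite -[1]mulr1; apply: ef => //; apply: (fX 0%N).
- move=> u v; apply: lspan_mul => {}u {}v.
  move=> /allpairsP[[a b] [/= ae /mapP[i _ ->] ->]] /allpairsP[[c d] [/= ce /mapP[j _ ->] ->]].
  by rewrite mulrACA -exprD; apply: ef => //; apply: eM; apply: lspan_mem.
- move=> y; rewrite inE => /orP[/eqP ->|/es ey]; last first.
    by rewrite -[y]mulr1; apply: ef => //; apply: (fX 0%N).
  by rewrite -[x]mul1r; apply: ef => //; apply: (fX 1%N).
Qed.

Lemma lspan_subfield (k K : fieldType) (iota : {rmorphism k -> K}) e :
  (forall x : K, exists2 q : {poly k}, q != 0 & root (map_poly iota q) x) ->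
  lspan iota e 1 ->
  (forall u v, lspan iota e u -> lspan iota e v -> lspan iota e (u * v)) ->
  is_subfield (lspan iota e).
Proof.
move=> alg e1 eM; split => //; first exact: lspanB.
move=> y ey; have [->|y0] := eqVneq y 0; first by rewrite invr0; apply: lspan0.
have [q q0 /rootP qy] := alg y.
(* Splitting off the power of ['X] dividing [q] leaves [q'] with nonzero constant term; it still
   vanishes at [y] because [y] is nonzero. *)
have [m [q' /implyP/(_ q0) + E]] := multiplicity_XsubC q 0.
have : (map_poly iota q').[y] = 0.
  move: qy; rewrite E rmorphM rmorphXn rmorphB /= map_polyX map_polyC /= rmorph0 subr0.
  rewrite hornerM hornerXn => /eqP; rewrite mulf_eq0 => /orP[/eqP //|].
  by rewrite expf_eq0 (negPf y0) andbF.
elim/poly_ind: q' {E} => [|r c _]; first by rewrite root0.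
rewrite rmorphD rmorphM /= map_polyX map_polyC /= hornerD hornerMX hornerC.
rewrite rootE hornerD hornerMX mulr0 add0r hornerC => Ey c0.
(* Here [q'] is [r * 'X + c%:P] with [c] nonzero, so [y * r(y) = - c]: the inverse of [y] is a
   polynomial in [y]. *)
have -> : y^-1 = iota (- c^-1) * (map_poly iota r).[y].
  apply: (mulfI y0); rewrite divff // mulrCA [y * _]mulrC.
  move/eqP: Ey; rewrite addr_eq0 => /eqP ->.
  by rewrite rmorphN mulrNN -rmorphM mulVf // rmorph1.
apply: lspanZ; apply: lspan_horner => i _.
by elim: i => [|i IH] //; rewrite exprS; apply: eM.
Qed.

Lemma finite_over_lspan (k K : fieldType) (iota : {rmorphism k -> K}) (E : K -> Prop) e :
  (forall x, E x -> lspan iota e x) -> finite_over iota E.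
Proof.
move=> Ee; exists (size e), (fun i => e`_i) => x /Ee; elim=> [|a y {}x ye _ [c ->]].
  by exists (fun=> 0); rewrite big1 // => i _; rewrite rmorph0 mul0r.
(* The list may contain repetitions; the new coefficient is added at the first occurrence of [y]
   only. *)
have lty : (index y e < size e)%N by rewrite index_mem.
exists (fun i => a *+ (i == Ordinal lty) + c i).
under [RHS]eq_bigr do rewrite rmorphD mulrDl.
rewrite big_split /=; congr (_ + _); rewrite (bigD1 (Ordinal lty)) //= eqxx nth_index //.
by rewrite big1 ?addr0 // => i /negPf ->; rewrite rmorph0 mul0r.
Qed.

Lemma finite_subfield_exists (k K : fieldType) (iota : {rmorphism k -> K}) :
  (forall x : K, exists2 q : {poly k}, q != 0 & root (map_poly iota q) x) ->
  forall s : seq K, exists F : K -> Prop,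
    [/\ is_subfield F, finite_over iota F, forall c, F (iota c) & forall x, x \in s -> F x].
Proof.
move=> alg s; have [e [e1 eM es]] := lspan_ring_exists alg s.
exists (lspan iota e); split => //; first exact: lspan_subfield.
  exact: (@finite_over_lspan _ _ _ _ e).
by move=> c; rewrite -[iota c]mulr1; apply: lspanZ.
Qed.

Lemma finite_over_sub (k K : fieldType) (iota : {rmorphism k -> K}) (E F : K -> Prop) :
  (forall x, E x -> F x) -> finite_over iota F -> finite_over iota E.
Proof. by move=> EF [m [e H]]; exists m, e => x /EF /H. Qed.

Lemma gen_field_subfield (k K : fieldType) (iota : {rmorphism k -> K}) (S : K -> Prop) :
  is_subfield (gen_field iota S).
Proof.
split.
- by move=> F [].
- by move=> x y Ex Ey F FS Fi Fs; case: (FS) => _ B _ _; apply: B; [apply: Ex|apply: Ey].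
- by move=> x y Ex Ey F FS Fi Fs; case: (FS) => _ _ M _; apply: M; [apply: Ex|apply: Ey].
- by move=> x Ex F FS Fi Fs; case: (FS) => _ _ _; apply; apply: Ex.
Qed.

(* The coordinate vectors of elements of [E] along the given spanning family form a
   subspace of [k^m]; a basis of it is a matrix of maximal rank with rows in it. *)
Lemma finite_over_inner (k K : fieldType) (iota : {rmorphism k -> K}) (E : K -> Prop) :
  is_subfield E -> (forall c, E (iota c)) -> finite_over iota E ->
  exists (m : nat) (e : 'I_m -> K), (forall i, E (e i)) /\
    forall x, E x -> exists c : 'I_m -> k, x = \sum_(i < m) iota (c i) * e i.
Proof.
move=> [E1 EB EM _] Ei [m [e eE]].
have E0 : E 0 by rewrite -(subrr 1); apply: EB.
have ED x y : E x -> E y -> E (x + y).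
  by move=> Ex Ey; rewrite -[y]opprK -[- y]sub0r; apply: (EB) => //; apply: EB.
pose ev (v : 'rV[k]_m) := \sum_(i < m) iota (v 0 i) * e i.
have evM q (w : 'rV_q) (B : 'M_(q, m)) :
    ev (w *m B) = \sum_(i < q) iota (w 0 i) * ev (row i B).
  rewrite /ev; under eq_bigr do rewrite mxE rmorph_sum mulr_suml.
  rewrite exchange_big; apply: eq_bigr => i _; rewrite mulr_sumr.
  by apply: eq_bigr => j _; rewrite mxE rmorphM mulrA.
have evE q (B : 'M_(q, m)) (u : 'rV_m) :
    (forall i, E (ev (row i B))) -> (u <= B)%MS -> E (ev u).
  move=> BE /submxP[w ->]; rewrite evM.
  by elim/big_ind: _ => // i _; apply: EM.
pose good r := `[< exists A : 'M[k]_m, (forall i, E (ev (row i A))) /\ \rank A = r >].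
have exg : exists r, good r.
  exists 0%N; apply/asboolP; exists 0; split; last exact: mxrank0.
  by move=> i; rewrite row0 /ev big1 // => j _; rewrite mxE rmorph0 mul0r.
have bound r : good r -> (r <= m)%N by move/asboolP=> [A [_ <-]]; exact: rank_leq_row.
case: (ex_maxnP exg bound) => r /asboolP[A [AE rA]] max.
exists m, (fun i => ev (row i A)); split=> // x Ex.
have [c Ec] := eE x Ex; pose v := \row_i c i.
have Ev : ev v = x by rewrite Ec; apply: eq_bigr => i _; rewrite mxE.
have /submxP[w Ew] : (v <= A)%MS.
  apply: contrapT => /negP nvA.
  have /max : good (\rank (A + v)%MS).
    apply/asboolP; exists (A + v)%MS; split=> // i.
    (* The rows of [A + v] are combinations of the rows of [A] and of [v], all of which evaluate
       into [E]; if [v] were outside the row space of [A], the rank would exceed its maximum. *)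
    apply: (evE _ (col_mx A v)); last by rewrite -addsmxE row_sub.
    move=> j; case: (split_ordP j) => l ->; first by rewrite rowKu.
    by rewrite rowKd row_id Ev.
  rewrite -rA leqNgt => /negP; apply.
  rewrite (ltn_leqif (mxrank_leqif_sup (addsmxSl A v))) addsmx_sub submx_refl.
  exact: nvA.
by exists (fun i => w 0 i); rewrite -Ev Ew evM.
Qed.

(** * Constants, monomials and Frobenius *)

Definition ps_mon (R : nzRingType) n (J : mi n) (c : R) : pseries R n :=
  fun I => if I == J then c else 0.

Lemma ps_monM (R : comNzRingType) n (J L : mi n) (c d : R) :
  ps_mon J c * ps_mon L d = ps_mon (J + L) (c * d).
Proof.
apply/funext => I; rewrite psM ps_mul_box /ps_mon; case: ifPn => [/eqP E|nE].
  have /mem_box_add/andP[JI LI] := esym E.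
  rewrite (bigD1_seq J) ?box_uniq //= [X in _ + X]big1 => [|M /negPf MJ]; last first.
    by rewrite big1 // => N _; rewrite MJ mul0r.
  rewrite addr0 eqxx (eq_bigl (pred1 L)) => [|M /=]; last first.
    by rewrite E (inj_eq (@mi_addIr n J)).
  by rewrite sum_pred1_seq ?box_uniq // eqxx.
rewrite big1 // => M _; rewrite big1 // => N /eqP E.
case: eqP => [MJ|]; last by rewrite mul0r.
case: eqP => [NL|]; last by rewrite mulr0.
by rewrite -E MJ NL eqxx in nE.
Qed.

Definition ps_const (R : nzRingType) n (c : R) : pseries R n := ps_mon 0 c.

Lemma ps_const_is_zmod (R : comNzRingType) n : zmod_morphism (@ps_const R n).
Proof.
move=> c d; apply/funext => I; rewrite psD psN /ps_const /ps_mon.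
by case: eqP => // _; rewrite subr0.
Qed.

Lemma ps_const_is_monoid (R : comNzRingType) n : monoid_morphism (@ps_const R n).
Proof.
split=> [|c d]; last by rewrite /ps_const ps_monM addr0.
by apply/funext => I; rewrite ps1 /ps_const /ps_mon; case: eqP.
Qed.

HB.instance Definition _ (R : comNzRingType) n :=
  GRing.isZmodMorphism.Build R (pseries R n) (@ps_const R n) (@ps_const_is_zmod R n).
HB.instance Definition _ (R : comNzRingType) n :=
  GRing.isMonoidMorphism.Build R (pseries R n) (@ps_const R n) (@ps_const_is_monoid R n).

Lemma ps_mul_const (R : comNzRingType) n (c : R) (f : pseries R n) I :
  (f * ps_const c) I = f I * c.
Proof.
rewrite mulrC psM ps_mul_box; have /mem_box_add/andP[I0 II] := add0r I.
rewrite (bigD1_seq 0) ?box_uniq //= [X in _ + X]big1 => [|M /negPf M0]; last first.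
  by rewrite big1 // => N _; rewrite /ps_const /ps_mon M0 mul0r.
rewrite addr0 (eq_bigl (pred1 I)) => [|M /=]; last by rewrite add0r.
by rewrite sum_pred1_seq ?box_uniq // /ps_const /ps_mon eqxx mulrC.
Qed.

(** Assuming [p \in [pchar R]] only for nonzero [p] treats all characteristics together: the
    exponent is 1 when [p] is 0. *)
Lemma frob_exp_gt0 (R : nzRingType) p r : (p != 0%N -> p \in [pchar R]) -> (0 < frob_exp p r)%N.
Proof.
rewrite /frob_exp; have [-> //|p0 /(_ isT) pR] := eqVneq p 0%N.
by rewrite expn_gt0 lt0n p0.
Qed.

Lemma exprD_frob (R : comNzRingType) p r (x y : R) :
  (p != 0%N -> p \in [pchar R]) ->
  (x + y) ^+ frob_exp p r = x ^+ frob_exp p r + y ^+ frob_exp p r.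
Proof.
rewrite /frob_exp; have [-> //|p0 /(_ isT) pR] := eqVneq p 0%N.
by apply: exprDn_pchar; rewrite pnatX pnatE ?pR // (pcharf_prime pR).
Qed.

Lemma exprN_frob (R : comNzRingType) p r (x : R) :
  (p != 0%N -> p \in [pchar R]) -> (- x) ^+ frob_exp p r = - x ^+ frob_exp p r.
Proof.
move=> pR; apply/eqP; rewrite -addr_eq0 -exprD_frob // addNr expr0n.
by rewrite gtn_eqF // (frob_exp_gt0 _ pR).
Qed.

Lemma ps_mon_exp (R : comNzRingType) n (J : mi n) (c : R) q :
  ps_mon J c ^+ q = ps_mon (J *+ q) (c ^+ q).
Proof.
elim: q => [|q IH]; last by rewrite !exprS IH ps_monM mulrS.
by rewrite !expr0 mulr0n; apply: esym (rmorph1 (@ps_const R n)).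
Qed.

(* Frobenius is additive on finite sums only: split [f] into its monomials below [I] and a
   remainder [h] vanishing on [box I], for which [h^q] has no coefficient at [I]. *)
Lemma ps_frobE (R : comNzRingType) n p r (f : pseries R n) I :
  (p != 0%N -> p \in [pchar R]) ->
  (f ^+ frob_exp p r) I =
  \sum_(J <- box I | J *+ frob_exp p r == I) f J ^+ frob_exp p r.
Proof.
move=> pR; have q0 := frob_exp_gt0 r pR.
have pS : p != 0%N -> p \in [pchar (pseries R n)].
  by move/pR; apply: (rmorph_pchar (@ps_const R n)).
set q := frob_exp p r; pose g : pseries R n := \sum_(J <- box I) ps_mon J (f J).
have gE J : J \in box I -> g J = f J.
  move=> JI; rewrite /g ps_sum (bigD1_seq J) ?box_uniq //= /ps_mon eqxx.
  by rewrite big1 ?addr0 // => L; rewrite eq_sym => /negPf ->.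
have -> : f ^+ q = g ^+ q + (f - g) ^+ q by rewrite -exprD_frob // addrC subrK.
rewrite psD.
have -> : ((f - g) ^+ q) I = 0.
  rewrite -(prednK q0 : q.-1.+1 = q) exprS psM ps_mul_box big_seq big1 // => J JI.
  by rewrite big1 // => L _; rewrite psD psN gE // subrr mul0r.
have frob_sum (s : seq (mi n)) (F : mi n -> pseries R n) :
    (\sum_(J <- s) F J) ^+ q = \sum_(J <- s) F J ^+ q.
  apply: (big_morph (fun x => x ^+ q)) => [x y|]; first exact: exprD_frob.
  by rewrite expr0n gtn_eqF.
rewrite addr0 frob_sum ps_sum big_mkcond /= [RHS]big_seq_cond big_seq.
rewrite [RHS]big_mkcondr; apply: eq_bigr => J JI; rewrite ps_mon_exp /ps_mon eq_sym.
by case: ifP.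
Qed.

Lemma ps_frob_coef (R : comNzRingType) n p r (f : pseries R n) J :
  (p != 0%N -> p \in [pchar R]) ->
  (f ^+ frob_exp p r) (J *+ frob_exp p r) = f J ^+ frob_exp p r.
Proof.
move=> pR; rewrite ps_frobE //; have q0 := frob_exp_gt0 r pR.
set q := frob_exp p r in q0 *.
have mulnE (L : mi n) i : (L *+ q) i = (L i * q)%N.
  by rewrite ffunMnE; elim: (q) => [|m IH]; rewrite ?muln0 // mulrS IH mulnS.
rewrite (eq_bigl (pred1 J)) => [|L /=].
  rewrite sum_pred1_seq ?box_uniq // mem_box; apply/forallP => i.
  by rewrite mulnE leq_pmulr.
apply/eqP/eqP => [/ffunP E|-> //]; apply/ffunP => i.
by apply/eqP; rewrite -(eqn_pmul2r q0) -!mulnE E.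
Qed.

(** * Coefficients of a simple root *)

Definition wt n (w : 'I_n -> nat) (I : mi n) : nat := (\sum_(i < n) I i * w i)%N.

Lemma wtD n (w : 'I_n -> nat) (I J : mi n) : wt w (I + J) = (wt w I + wt w J)%N.
Proof.
by rewrite /wt -big_split; apply: eq_bigr => i _; rewrite mi_addE mulnDl.
Qed.

(** Reduction modulo [B] recovers the lowest digit; cancelling it and dividing by [B] leaves one
    digit fewer. *)
Lemma digits_inj B n (f g : 'I_n -> nat) :
  (forall i, f i < B)%N -> (forall i, g i < B)%N ->
  (\sum_(i < n) f i * B ^ i = \sum_(i < n) g i * B ^ i)%N -> f =1 g.
Proof.
elim: n f g => [|n IH] f g fB gB E i; first by case: i.
have split (h : 'I_n.+1 -> nat) : (\sum_(i < n.+1) h i * B ^ i =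
    (\sum_(i < n) h (lift ord0 i) * B ^ i) * B + h ord0)%N.
  rewrite big_ord_recl expn0 muln1 addnC big_distrl /=; congr addn.
  by apply: eq_bigr => j _; rewrite /bump /= expnS mulnA mulnAC.
move: E; rewrite !split => E.
have B0 : (0 < B)%N by apply: leq_ltn_trans (fB ord0).
have E0 : f ord0 = g ord0.
  by have /(congr1 (modn^~ B)) := E; rewrite !modnMDl !modn_small.
move/eqP: E; rewrite E0 eqn_add2r eqn_pmul2r // => /eqP /IH E.
by case: (unliftP ord0 i) => [j ->|-> //]; apply: E.
Qed.

(* With [e] the least degree in [S], weights [C + B^i] with [C] large and [B = e + 1] order
   by degree first and by base-[B] digits within degree [e]. *)
Lemma separating_weight n (S : mi n -> Prop) : (exists I, S I) ->
  exists w : 'I_n -> nat, (forall i, 0 < w i)%N /\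
    exists2 D, S D & forall J, S J -> J != D -> (wt w D < wt w J)%N.
Proof.
move=> [I SI]; pose deg (J : mi n) := (\sum_(i < n) J i)%N.
have [e [[J0 SJ0 degJ0] emin]] :
    exists e, (exists2 J, S J & deg J = e) /\ forall J, S J -> (e <= deg J)%N.
  have exd : exists d, `[< exists2 J, S J & deg J = d >].
    by exists (deg I); apply/asboolP; exists I.
  case: (ex_minnP exd) => e /asboolP H min; exists e; split => // J SJ.
  by apply: min; apply/asboolP; exists J.
(* [C] exceeds the digit sum of every exponent of degree [e], whose entries are at most [e]. One
   more unit of degree therefore outweighs any difference in digits. *)
pose B := e.+1; pose C := (\sum_(i < n) e * B ^ i).+1.
pose w (i : 'I_n) := (C + B ^ i)%N; pose dig (J : mi n) := (\sum_(i < n) J i * B ^ i)%N.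
have wtE J : wt w J = (deg J * C + dig J)%N.
  by rewrite /wt big_distrl -big_split; apply: eq_bigr => i _; rewrite mulnDr.
have le_deg (J : mi n) i : (J i <= deg J)%N by rewrite /deg (bigD1 i) //= leq_addr.
have exw : exists d, `[< exists2 J, S J & wt w J = d >].
  by exists (wt w I); apply/asboolP; exists I.
case: (ex_minnP exw) => m /asboolP[D SD wD] min.
have minw J : S J -> (wt w D <= wt w J)%N.
  by move=> SJ; rewrite wD; apply: min; apply/asboolP; exists J.
have dege J : S J -> (wt w J <= wt w D)%N -> deg J = e.
  move=> SJ le; apply/eqP; rewrite eqn_leq emin // andbT leqNgt; apply/negP => lt.
  have := leq_trans le (minw _ SJ0); apply/negP; rewrite -ltnNge !wtE degJ0.
  apply: (@leq_trans (e.+1 * C)); last by rewrite (leq_trans _ (leq_addr _ _)) // leq_mul2r lt orbT.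
  rewrite mulSnr ltn_add2l ltnS; apply: leq_sum => i _.
  by rewrite leq_mul2r -degJ0 le_deg orbT.
exists w; split; first by move=> i; rewrite /w /C addSn.
(* A [J] no heavier than [D] has the same degree [e] and the same weight, hence the same base-[B]
   digits. *)
exists D => // J SJ; apply: contraNltn => le.
have eJ := dege _ SJ le; have eD := dege _ SD (leqnn _).
have /eqP : wt w J = wt w D by apply/eqP; rewrite eqn_leq le minw.
rewrite !wtE eJ eD eqn_add2l => /eqP E; apply/eqP/ffunP; apply: digits_inj E => i.
  by rewrite ltnS -eJ.
by rewrite ltnS -eD.
Qed.

Lemma wt_bounded n (w : 'I_n -> nat) N : (forall i, 0 < w i)%N ->
  exists s : seq (mi n), forall I, (wt w I <= N)%N -> I \in s.
Proof.
move=> w0; exists (box [ffun=> N]) => I le; rewrite mem_box; apply/forallP => i.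
rewrite ffunE; apply: leq_trans le; rewrite /wt (bigD1 i) //=.
by apply: leq_trans (leq_addr _ _); rewrite leq_pmulr.
Qed.

(** A lower bound on the weighted order; in this form the zero series needs no infinite value. *)
Definition ps_ord_ge (R : nzRingType) n (w : 'I_n -> nat) m (f : pseries R n) : Prop :=
  forall I, (wt w I < m)%N -> f I = 0.

Lemma ps_ord_geM (R : comNzRingType) n (w : 'I_n -> nat) a b (f g : pseries R n) :
  ps_ord_ge w a f -> ps_ord_ge w b g -> ps_ord_ge w (a + b) (f * g).
Proof.
move=> fa gb I lt; rewrite psM ps_mul_box big1 // => J _; rewrite big1 // => L /eqP E.
have [Ja|aJ] := ltnP (wt w J) a; first by rewrite fa // mul0r.
rewrite gb ?mulr0 // -(ltn_add2l (wt w J)) -wtD E.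
by apply: leq_trans lt _; rewrite leq_add2r.
Qed.

Lemma ps_ord_ge0 (R : comNzRingType) n (w : 'I_n -> nat) (f : pseries R n) :
  ps_ord_ge w 0 f.
Proof. by []. Qed.

(* The only product contributing at [D + I] is the one of the two extreme terms. *)
Lemma ps_mul_extreme (R : comNzRingType) n (w : 'I_n -> nat) (f g : pseries R n) D I :
  (forall J, f J != 0 -> J != D -> (wt w D < wt w J)%N) -> ps_ord_ge w (wt w I) g ->
  (f * g) (D + I) = f D * g I.
Proof.
move=> fD gI; rewrite psM ps_mul_box.
have /mem_box_add/andP[DM IM] := erefl (D + I).
rewrite (bigD1_seq D) ?box_uniq //= [X in _ + X]big1 => [|J JD].
  rewrite addr0 (eq_bigl (pred1 I)) ?sum_pred1_seq ?box_uniq // => J /=.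
  by rewrite (inj_eq (@mi_addIr n D)).
rewrite big1 // => L /eqP /(congr1 (wt w)); rewrite !wtD => E.
have [->|fJ] := eqVneq (f J) 0; first by rewrite mul0r.
rewrite gI ?mulr0 //; have := fD _ fJ JD; lia.
Qed.

Lemma horner_taylor1 (R : comNzRingType) (P : {poly R}) x h :
  exists Q, P.[x + h] = P.[x] + h * Q.
Proof.
elim/poly_ind: P => [|P c [Q E]]; first by exists 0; rewrite !horner0 mulr0 addr0.
exists (P.[x] + Q * (x + h)); rewrite !hornerMXaddC E; ring.
Qed.

(** The remainder is left unspecified: only its factor [h * h] matters for estimates of order. *)
Lemma horner_taylor2 (R : comNzRingType) (P : {poly R}) x h :
  exists Q, P.[x + h] = P.[x] + h * P^`().[x] + h * h * Q.
Proof.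
elim/poly_ind: P => [|P c [Q E]].
  by exists 0; rewrite deriv0 !horner0 !mulr0 !addr0.
exists (P^`().[x] + Q * (x + h)).
by rewrite derivMXaddC !hornerMXaddC hornerD hornerMX E; ring.
Qed.

Lemma subfield_horner (k K : fieldType) (iota : {rmorphism k -> K}) n (F : K -> Prop)
  (P : {poly pseries k n}) (f : pseries K n) :
  is_subfield F -> (forall c, F (iota c)) -> (forall I, F (f I)) ->
  forall I, F ((map_poly (@ps_map k K iota n) P).[f] I).
Proof.
move=> [F1 FB FM _] Fi Ff.
have F0 : F 0 by rewrite -(subrr 1); apply: FB.
have FD x y : F x -> F y -> F (x + y).
  by move=> Fx Fy; rewrite -[y]opprK -[- y]sub0r; apply: (FB) => //; apply: FB.
elim/poly_ind: P => [|P c IH] I; first by rewrite rmorph0 horner0.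
rewrite rmorphD rmorphM /= map_polyX map_polyC /= hornerMXaddC psD.
apply: (FD); last exact: Fi.
rewrite psM ps_mul_box; elim/big_ind: _ => // J _; elim/big_ind: _ => // L _.
exact: FM.
Qed.

(** The list [s] holds the exponents of weight at most that of [D], and is fixed before [F]. A
    finite extension can then be chosen to contain these coefficients. The others follow by strong
    induction on the weight. *)
Lemma simple_root_coefs (k K : fieldType) (iota : {rmorphism k -> K}) n
  (P : {poly pseries k n}) (tau : pseries K n) :
  (map_poly (@ps_map k K iota n) P).[tau] = 0 ->
  (map_poly (@ps_map k K iota n) P)^`().[tau] != 0 ->
  exists s : seq (mi n), forall F : K -> Prop, is_subfield F ->
    (forall c, F (iota c)) -> (forall I, I \in s -> F (tau I)) -> forall I, F (tau I).
Proof.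
set PK := map_poly _ P => Ptau; set delta := PK^`().[tau] => delta0.
have [|w [w0 [D deltaD Dmin]]] := @separating_weight n (fun I => delta I != 0).
  apply: contrapT => /forallNP H; move/eqP: delta0; apply; apply/funext => I.
  by apply/eqP; have /negP := H I; rewrite negbK.
have [s sP] := wt_bounded (wt w D) w0; exists s => F Fsub Fi Fs I.
have [m] := ubnP (wt w I); elim: m I => // m IH I; rewrite ltnS => leI.
have [leD|ltD] := leqP (wt w I) (wt w D); first exact/Fs/sP.
case: (Fsub) => F1 FB FM FV.
have F0 : F 0 by rewrite -(subrr 1); apply: FB.
(* The truncation [g] of [tau] has all its coefficients in [F] by induction, hence so do the values
   of [PK] and its derivative at [g]. *)
pose g : pseries K n := fun J => if (wt w J < wt w I)%N then tau J else 0.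
pose h := tau - g.
have Fg J : F (g J).
  by rewrite /g; case: ifP => // lt; apply: IH; apply: leq_trans lt leI.
have hI : ps_ord_ge w (wt w I) h.
  by move=> J lt; rewrite /h psD psN /g lt subrr.
have hIE : h I = tau I by rewrite /h psD psN /g ltnn subr0.
have gE : g = tau + - h by rewrite /h opprB addrC subrK.
have FP J : F (PK.[g] J) by apply: subfield_horner.
have FP' J : F (PK^`().[g] J) by rewrite deriv_map; apply: subfield_horner.
have [Q' EQ'] := horner_taylor1 PK^`() tau (- h).
(* The derivative at [g] differs from [delta] by a multiple of [h], of order at least [wt w I],
   which exceeds [wt w D]. Thus [delta D] lies in [F]. *)
have deltaE : delta D = PK^`().[g] D.
  rewrite gE EQ' psD mulNr psN [(h * Q') D](ps_ord_geM hI (@ps_ord_ge0 _ _ w Q')).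
    by rewrite subr0.
  by rewrite addn0.
have [Q EQ] := horner_taylor2 PK tau (- h).
have E : PK.[g] (D + I) = - (delta D * tau I).
  rewrite gE EQ Ptau add0r -/delta mulNr mulrNN psD psN.
  rewrite [h * delta]mulrC (ps_mul_extreme Dmin hI) hIE.
  (* The quadratic remainder has order at least [2 * wt w I], beyond the weight of [D + I]. *)
  rewrite [(h * h * Q) _](ps_ord_geM (ps_ord_geM hI hI) (@ps_ord_ge0 _ _ w Q)).
    by rewrite addr0.
  by rewrite wtD addn0 ltn_add2r.
have -> : tau I = (0 - PK.[g] (D + I)) * (PK^`().[g] D)^-1.
  by rewrite E sub0r opprK -deltaE mulrAC divff // mul1r.
by apply: (FM); [apply: FB|apply: FV].
Qed.

(** * Algebraic power series *)

Lemma ps_algebraicP (k K : fieldType) (iota : {rmorphism k -> K}) n (sigma : pseries K n) :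
  ps_algebraic iota sigma <->
  exists2 P : {poly pseries k n}, P != 0 & (map_poly (@ps_map k K iota n) P).[sigma] = 0.
Proof.
split=> [[d [a [[j [I aj] E]]]]|[P P0 E]].
  exists (\poly_(i < d.+1) a (inord i)).
    apply: contraNneq aj => /(congr1 (fun q : {poly _} => q`_j)).
    by rewrite coef_poly ltn_ord inord_val coef0 => ->.
  apply/funext => M; rewrite ps0 -[RHS](E M) (@horner_coef_wide _ d.+1); last first.
    by apply: leq_trans (size_poly _ _) _; apply: size_poly.
  rewrite ps_sum; apply: eq_bigr => i _.
  by rewrite coef_map coef_poly ltn_ord inord_val psM psX.
exists (size P).-1, (fun i => P`_i); split.
  exists ord_max; apply: contrapT => /forallNP H; move/eqP: P0; apply.
  apply/eqP; rewrite -lead_coef_eq0; apply/eqP/funext => M.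
  by apply/eqP; have /negP := H M; rewrite negbK.
move=> M; have := congr1 (@^~ M) E; rewrite ps0 => EM.
rewrite -[RHS]EM (@horner_coef_wide _ (size P).-1.+1); last first.
  by apply: leq_trans (size_poly _ _) _; apply: leqSpred.
by rewrite ps_sum; apply: eq_bigr => i _; rewrite coef_map psM psX.
Qed.

Lemma ps_map_inj (k K : fieldType) (iota : {rmorphism k -> K}) n :
  injective (@ps_map k K iota n).
Proof.
move=> f g E; apply/funext => I; apply: (fmorph_inj iota).
by have := congr1 (@^~ I) E.
Qed.

Lemma is_char_pchar (k K : fieldType) (iota : {rmorphism k -> K}) p :
  is_char k p -> p != 0%N -> p \in [pchar K].
Proof. by rewrite /is_char => + /negPf p0; rewrite p0; apply: rmorph_pchar. Qed.

(* Among all relations for all [sigma^(p^r)], one of least degree is separable: otherwise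
   it would be a polynomial in [T^p], i.e. a smaller relation for [sigma^(p^(r+1))]. *)
Lemma separable_relation (k K : fieldType) (iota : {rmorphism k -> K}) p n
  (sigma : pseries K n) : is_char k p -> ps_algebraic iota sigma ->
  exists r (P : {poly pseries k n}),
    (map_poly (@ps_map k K iota n) P).[sigma ^+ frob_exp p r] = 0 /\
    (map_poly (@ps_map k K iota n) P)^`().[sigma ^+ frob_exp p r] != 0.
Proof.
move=> hp /ps_algebraicP[P0 P0n0 E0]; set f := @ps_map k K iota n in E0 *.
pose good d := `[< exists r (P : {poly pseries k n}),
  [/\ P != 0, (map_poly f P).[sigma ^+ frob_exp p r] = 0 & size P = d] >].
have exg : exists d, good d.
  exists (size P0); apply/asboolP; exists 0%N, P0; split=> //.
  by rewrite /frob_exp expn0 if_same expr1.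
case: (ex_minnP exg) => d /asboolP[r [P [Pn0 E dP]]] min.
exists r, P; split=> //; rewrite deriv_map; apply/negP => /eqP E'.
have P1 : (1 < size P)%N.
  rewrite ltnNge; apply/negP => /size1_polyC Pc; move: E Pn0.
  rewrite Pc map_polyC hornerC polyC_eq0 => /eqP; rewrite -(rmorph0 f).
  by rewrite (inj_eq (@ps_map_inj k K iota n)) => ->.
(* The derivative also annihilates the same power of [sigma] and is smaller than [P], so minimality
   forces it to vanish. *)
have dP0 : P^`() = 0.
  apply/eqP; apply: contraT => dPn0.
  have : good (size P^`()) by apply/asboolP; exists r, P^`().
  by move/min; rewrite -dP leqNgt lt_size_deriv.
have coefP i M : P`_i M *+ i = 0.
  case: i => [|i]; first by rewrite mulr0n.
  have /(congr1 (fun q : {poly pseries k n} => q`_i M)) := dP0; rewrite coef_deriv coef0.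
  by rewrite psMn ps0.
move: (hp); rewrite /is_char; case: eqP => [p0|/eqP p0] pk.
  (* In characteristic 0 the leading coefficient times the positive degree cannot vanish. *)
  have : lead_coef P != 0 by rewrite lead_coef_eq0.
  move/eqP; apply; apply/funext => M; apply/eqP.
  have /eqP := coefP (size P).-1 M; rewrite -mulr_natr mulf_eq0 => /orP[//|].
  by move/pcharf0P: pk => ->; lia.
have pp := pcharf_prime pk.
have PV i : ~~ (p %| i)%N -> P`_i = 0.
  move=> npi; apply/funext => M; apply/eqP; have /eqP := coefP i M.
  by rewrite -mulr_natr mulf_eq0 -(dvdn_pcharf pk) (negPf npi) orbF.
(* The bound makes [Q] smaller than [P], yet loses nothing: if [i >= size P - 1], then
   [i * p >= 2 * i >= size P], since [size P] and [p] are at least 2. *)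
pose Q : {poly pseries k n} := \poly_(i < (size P).-1) P`_(i * p).
have PQ : P = Q \Po 'X^p.
  apply/polyP => i; rewrite coef_comp_poly_Xn ?prime_gt0 //; case: ifPn => [pi|/PV //].
  rewrite coef_poly divnK //; case: ltnP => // le; rewrite nth_default //.
  rewrite -(divnK pi); apply: (@leq_trans (i %/ p * 2)).
    by move: (i %/ p)%N (size P) le P1 => a b; lia.
  by rewrite leq_mul2l prime_gt1 ?orbT.
have : good (size Q).
  apply/asboolP; exists r.+1, Q; split=> //.
    by apply: contraNneq Pn0 => Q0; rewrite PQ Q0 comp_poly0.
  move: E; rewrite PQ map_comp_poly map_polyXn horner_comp hornerXn -exprM.
  by rewrite /frob_exp (negPf p0) expnSr.
move/min; rewrite -dP; apply/negP; rewrite -ltnNge.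
by apply: leq_ltn_trans (size_poly _ _) _; rewrite ltn_predL ltnW.
Qed.

Lemma algebraic_finite (k K : fieldType) (iota : {rmorphism k -> K}) p n (sigma : pseries K n) :
  (forall x : K, exists2 q : {poly k}, q != 0 & root (map_poly iota q) x) ->
  is_char k p -> ps_algebraic iota sigma ->
  exists r, finite_over iota
    (gen_field iota (frob_image p r (gen_field iota (fun a => exists I, a = sigma I)))).
Proof.
move=> alg hp /(separable_relation hp)[r [P [E E']]]; exists r.
have pK := is_char_pchar iota hp.
have [s sP] := simple_root_coefs E E'.
have [F [Fsub Ffin Fi Fs]] :=
  finite_subfield_exists alg (map (sigma ^+ frob_exp p r : pseries K n) s).
have Fall := sP F Fsub Fi (fun I Is => Fs _ (map_f _ Is)).
apply: finite_over_sub Ffin => x; apply => // _ [y Ly ->].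
(* The elements whose Frobenius power lies in [F] form a subfield containing [k] and the
   coefficients of [sigma], hence all of [L]. *)
apply: (Ly (fun z => F (z ^+ frob_exp p r))).
- case: Fsub => F1 FB FM FV; split.
  + by rewrite expr1n.
  + by move=> u v Fu Fv; rewrite exprD_frob // exprN_frob //; apply: FB.
  + by move=> u v Fu Fv; rewrite exprMn; apply: FM.
  + by move=> u Fu; rewrite exprVn; apply: FV.
- by move=> c; rewrite -rmorphXn; apply: Fi.
- by move=> _ [I ->]; rewrite -ps_frob_coef //; apply: Fall.
Qed.

(** The determinant trick: the determinant of [tau - A] annihilates each [e i], hence also 1, which
    is a combination of them. The family need only span. *)
Lemma integral_of_finite (k K : fieldType) (iota : {rmorphism k -> K}) n
  (tau : pseries K n) m (e : 'I_m -> K) (a : 'I_m -> k) :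
  1 = \sum_(i < m) iota (a i) * e i ->
  (forall I i, exists c : 'I_m -> k, tau I * e i = \sum_(j < m) iota (c j) * e j) ->
  exists2 P : {poly pseries k n}, P \is monic & (map_poly (@ps_map k K iota n) P).[tau] = 0.
Proof.
move=> a1 H; set f := @ps_map k K iota n.
have [c cE] := choice (fun u : mi n * 'I_m => H u.1 u.2).
(* Expanding each coefficient of [tau] times [e i] separately and collecting over [I] gives entries
   that are series over [k]. *)
pose A : 'M[pseries k n]_m := \matrix_(i, j) (fun I => c (I, i) j).
exists (char_poly A); first exact: char_poly_monic.
pose M : 'M[pseries K n]_m := tau%:M - map_mx f A.
pose v : 'cV[pseries K n]_m := \col_i ps_const (e i).
have Mv : M *m v = 0.
  apply/colP => i; rewrite mulmxBl mul_scalar_mx !mxE; apply/eqP.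
  rewrite subr_eq0; apply/eqP/funext => I; rewrite ps_mul_const (cE (I, i)).
  by rewrite ps_sum; apply: eq_bigr => j _; rewrite !mxE ps_mul_const.
have detv : \det M *: v = 0.
  by rewrite -mul_scalar_mx -mul_adj_mx -mulmxA Mv mulmx0.
have -> : (map_poly f (char_poly A)).[tau] = \det M.
  rewrite map_char_poly -[LHS]/(horner_eval tau _) -det_map_mx; congr (\det _).
  apply/matrixP => i j; rewrite !mxE /= /horner_eval hornerD hornerN hornerC hornerMn hornerX.
  by [].
have -> : \det M = \sum_(i < m) ps_const (iota (a i)) * (\det M * ps_const (e i)).
  under eq_bigr do rewrite mulrCA -rmorphM.
  by rewrite -mulr_sumr -rmorph_sum -a1 rmorph1 mulr1.
rewrite big1 // => i _; have /matrixP/(_ i 0) := detv; rewrite !mxE => ->.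
by rewrite mulr0.
Qed.

Lemma finite_algebraic (k K : fieldType) (iota : {rmorphism k -> K}) p r n
  (sigma : pseries K n) : is_char k p ->
  finite_over iota
    (gen_field iota (frob_image p r (gen_field iota (fun a => exists I, a = sigma I)))) ->
  ps_algebraic iota sigma.
Proof.
move=> hp; set E := gen_field _ _ => Efin; have pK := is_char_pchar iota hp.
have Esub : is_subfield E by apply: gen_field_subfield.
have Ei c : E (iota c) by move=> F _ Fi _.
(* The spanning family must lie inside [E], so that its products with coefficients of the Frobenius
   power of [sigma] stay in [E] and can be expanded again. *)
have [m [e [Ee eE]]] := finite_over_inner Esub Ei Efin.
case: Esub => E1 EB EM _; have E0 : E 0 by rewrite -(subrr 1); apply: EB.
have ED x y : E x -> E y -> E (x + y).
  by move=> Ex Ey; rewrite -[y]opprK -[- y]sub0r; apply: (EB) => //; apply: EB.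
have Etau I : E ((sigma ^+ frob_exp p r) I).
  rewrite ps_frobE //; elim/big_ind: _ => // J _ F _ _; apply.
  by exists (sigma J) => // G _ _; apply; exists J.
have [a a1] := eE 1 E1.
have [P Pm P0] := integral_of_finite a1 (fun I i => eE _ (EM _ _ (Etau I) (Ee i))).
have q0 := frob_exp_gt0 r pK.
apply/ps_algebraicP; exists (P \Po 'X^(frob_exp p r)); last first.
  by rewrite map_comp_poly map_polyXn horner_comp hornerXn.
apply: contraTneq Pm => PX; have -> : P = 0; last by rewrite monicE lead_coef0 eq_sym oner_eq0.
(* The coefficient of [P] at [i] reappears in the composite at [i * frob_exp p r], so a zero
   composite would force [P = 0]. *)
apply/polyP => i; rewrite coef0.
have := coef_comp_poly_Xn P (i * frob_exp p r) q0.
by rewrite PX coef0 dvdn_mull // mulnK.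
Qed.

Unset Implicit Arguments.

Theorem theorem3p2 (k : fieldType) (K : closedFieldType) (iota : {rmorphism k -> K})
  (K_alg : forall x : K, exists2 q : {poly k}, q != 0 & root (map_poly iota q) x)
  (p : nat) (hp : is_char k p) (n : nat) (sigma : pseries K n) :
  let L := gen_field iota (fun a => exists I, a = sigma I) in
  ps_algebraic iota sigma <->
  exists r : nat, finite_over iota (gen_field iota (frob_image p r L)).
Proof.
move=> L; split; first exact: algebraic_finite.
by move=> [r]; apply: finite_algebraic.
Qed.
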